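(* Let $X$ be a finite set, and let $(X,S)$ be a non-degenerate symmetric set-theoretical solution of the quantum Yang-Baxter equation. Then $(X,S)$ is decomposable if and only if it has a strong folding $(X',S')$ which is a trivial solution and such that $\# X'=2$.
   Context: Solutions. Let $X$ be a set and $S:X\times X\to X\times X$ a bijection; write $S(x,y)=(g_x(y),f_y(x))$. The pair $(X,S)$ is non-degenerate if $f_x$ and $g_x$ are bijections of $X$ for every $x\in X$; involutive if $S\circ S=\mathrm{id}_{X\times X}$; braided if $S^{12}S^{23}S^{12}=S^{23}S^{12}S^{23}$ on $X^3$, where $S^{12}=S\times \mathrm{id}_X$, $S^{23}=\mathrm{id}_X\times S$; symmetric if it is involutive and braided. A non-degenerate symmetric set-theoretical solution of the quantum Yang-Baxter equation is a pair $(X,S)$ that is non-degenerate and symmetric. It is trivial if all $f_x$, $g_x$ are the identity, i.e. $S(x,y)=(y,x)$. Its structure group is $G(X,S)=\langle X\mid xy=g_x(y)f_y(x)\ \ (x,y\in X)\rangle$. A subset $Y\subseteq X$ is invariant if $S(Y\times Y)\subseteq Y\times Y$; an invariant subset $Y$ is non-degenerate if $(Y,S|_{Y\times Y})$ is non-degenerate and symmetric. $(X,S)$ is decomposable if $X$ is the union of two nonempty disjoint non-degenerate invariant subsets. Garside monoids. In a monoid, $x$ is a left (resp. right) divisor of $z$ if $z=xt$ (resp. $z=tx$) for some $t$. A monoid is cancellative if $xyz=xtz$ implies $y=t$. It is noetherian if every sequence $(x_n)$ in which each $x_{n+1}$ is a left divisor of $x_n$ stabilizes, and likewise for right divisors.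 A locally Garside monoid is a cancellative noetherian monoid in which, for each of left-divisibility and right-divisibility, any two elements have a common multiple if and only if they have a least common multiple. An element $\Delta$ is balanced if its sets of left and right divisors coincide; this set is then denoted $\operatorname{Div}(\Delta)$. A Garside element is a balanced element $\Delta$ such that $\operatorname{Div}(\Delta)$ generates the monoid; a Garside monoid is a locally Garside monoid having a Garside element. A Garside monoid has a unique minimal Garside element, called the Garside element. An atom is an element $x\ne 1$ such that $x=yz$ implies $y=1$ or $z=1$. For $X$ finite, the submonoid $M=M(X,S)$ of $G(X,S)$ generated by $X$ has, as a monoid, the same presentation as $G(X,S)$; it is a Garside monoid with atom set $X$ and enveloping group $G(X,S)$. Its Garside element is denoted $\Delta$. Any two elements have left and right gcds and lcms. The right lcm $x\vee y$ is the lcm for left-divisibility. The right complement of $x,y$ is the element $z$ with $xz=x\vee y$; left complements are defined dually. Parabolic and Garside subgroups. A submonoid $N$ of $M$ is standard parabolic if there is a balanced $\delta\in\operatorname{Div}(\Delta)$ such that $\operatorname{Div}(\delta)$ generates $N$ and $N\cap\operatorname{Div}(\Delta)=\operatorname{Div}(\delta)$; a standard parabolic subgroup of $G(X,S)$ is a subgroup generated by a standard parabolic submonoid. A submonoid $N$ of $M$ is a Garside submonoid if it is generated by a non-empty subset $D\subseteq\operatorname{Div}(\Delta)$ which is a sublattice of $\operatorname{Div}(\Delta)$ for left and for right divisibility, is closed under left and right complements, and is such that for all $x,y\in D$ the left gcd and the right gcd of $xy$ and $\Delta$ in $M$ belong to $D$. The subgroup of $G(X,S)$ generated by $N$ is then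 a Garside subgroup, with atom set that of $N$ and Garside element that of $N$ (the minimal Garside element of the Garside monoid $N$). $N$ (and the subgroup) is atomic if the atoms of $N$ are atoms of $M$. Foldings. A partition $X=X_1\cup\cdots\cup X_k$ is proper if each $X_i$ is nonempty and $1<k<|X|$. $(X,S)$ is foldable if $X$ has a proper partition $X_1\cup\cdots\cup X_k$ such that (1) every $X_i$ generates an atomic Garside subgroup, with Garside element $\Delta_i$; and (2) the set $X'=\{\Delta_1,\dots,\Delta_k\}$ is closed under right and left complements in $M(X,S)$ (of pairs of distinct elements) and is the atom set of a Garside subgroup of $G(X,S)$. In this case let $S':X'\times X'\to X'\times X'$ be the induced bijection, i.e. the unique bijection such that $(X',S')$ is a non-degenerate symmetric solution and $S'(a,b)=(c,d)$ whenever $a,b,c,d\in X'$, $a\neq c$ and $ab=cd=a\vee c$. Then $(X',S')$ is called a folding of $(X,S)$. If moreover each $X_i$ generates a standard parabolic subgroup of $G(X,S)$, then $(X,S)$ is strongly foldable and $(X',S')$ is a strong folding of $(X,S)$.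
   Formalization: The case #X = 2 is excluded: there no proper partition (1 < k < #X) and hence no folding exists, although the trivial solution on two elements is decomposable, so the claim as stated fails for it. *)

(* Defs.v *)
From HB Require Import structures.
From mathcomp Require Import all_boot.
From mathcomp Require Import boolp classical_sets cardinality.

Set Implicit Arguments.
Unset Strict Implicit.
Unset Printing Implicit Defensive.

Local Open Scope classical_set_scope.
Local Open Scope quotient_scope.
Local Open Scope group_scope.

(** * Set-theoretical solutions *)

Section Solutions.
Variables (T : Type) (S : T * T -> T * T).

(* S (x, y) = (g_x y, f_y x); the index is the first argument of [sol_g] and
   of [sol_f]. *)
Definition sol_g (x y : T) : T := (S (x, y)).1.
Definition sol_f (y x : T) : T := (S (x, y)).2.

Definition nondegenerate : Prop :=
  forall x, bijective (sol_f x) /\ bijective (sol_g x).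

Definition S12 (p : T * T * T) : T * T * T := (S p.1, p.2).
Definition S23 (p : T * T * T) : T * T * T :=
  let q := S (p.1.2, p.2) in (p.1.1, q.1, q.2).

Definition braided : Prop := S12 \o S23 \o S12 =1 S23 \o S12 \o S23.

Definition symmetric_solution : Prop := involutive S /\ braided.

Definition nondeg_symmetric_solution : Prop :=
  [/\ bijective S, nondegenerate & symmetric_solution].

Definition trivial_solution : Prop :=
  forall x, sol_f x =1 id /\ sol_g x =1 id.

End Solutions.

Section Decomposability.
Variables (X : finType) (S : X * X -> X * X).

Definition invariant_subset (Y : {set X}) : Prop :=
  forall p : X * X, p.1 \in Y -> p.2 \in Y ->
    ((S p).1 \in Y) /\ ((S p).2 \in Y).

Definition restrict_solution (Y : {set X}) (invY : invariant_subset Y)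
    (p : {x | x \in Y} * {x | x \in Y}) : {x | x \in Y} * {x | x \in Y} :=
  let SY := invY (val p.1, val p.2) (valP p.1) (valP p.2) in
  (exist _ (S (val p.1, val p.2)).1 SY.1, exist _ (S (val p.1, val p.2)).2 SY.2).

Definition nondeg_invariant_subset (Y : {set X}) : Prop :=
  exists invY : invariant_subset Y,
    nondegenerate (restrict_solution invY) /\
    symmetric_solution (restrict_solution invY).

Definition decomposable : Prop :=
  exists Y Z : {set X},
    [/\ Y <> finset.set0, Z <> finset.set0, (Y :&: Z)%SET = finset.set0,
        (Y :|: Z = [set: X])%SET
      & nondeg_invariant_subset Y /\ nondeg_invariant_subset Z].

End Decomposability.

(** * The structure group *)

Section StructureGroup.
Variables (X : choiceType) (S : X * X -> X * X).

(* Words in the letters x = (true, x) and x^-1 = (false, x). *)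
Notation word := (seq (bool * X)).

Inductive sg_cong : word -> word -> Prop :=
  | sg_refl u : sg_cong u u
  | sg_sym u v : sg_cong u v -> sg_cong v u
  | sg_trans u v w : sg_cong u v -> sg_cong v w -> sg_cong u w
  | sg_cat u u' v v' :
      sg_cong u u' -> sg_cong v v' -> sg_cong (u ++ v) (u' ++ v')
  | sg_cancel b x : sg_cong [:: (b, x); (~~ b, x)] [::]
  | sg_relator x y :
      sg_cong [:: (true, x); (true, y)]
              [:: (true, sol_g S x y); (true, sol_f S y x)].

Definition sg_congb : rel word := fun u v => `[< sg_cong u v >].

Fact sg_congb_refl : reflexive sg_congb.
Proof. by move=> u; apply/asboolP; apply: sg_refl. Qed.

Fact sg_congb_sym : symmetric sg_congb.
Proof. by move=> u v; apply/asboolP/asboolP => /sg_sym. Qed.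

Fact sg_congb_trans : transitive sg_congb.
Proof.
by move=> v u w /asboolP uv /asboolP vw; apply/asboolP; apply: sg_trans vw.
Qed.

Canonical sg_equiv :=
  EquivRel sg_congb sg_congb_refl sg_congb_sym sg_congb_trans.

Definition structure_group : Type := {eq_quot sg_equiv}.
HB.instance Definition _ := Choice.copy structure_group {eq_quot sg_equiv}.

Definition sg_class (u : word) : structure_group := \pi_({eq_quot sg_equiv}) u.

Fact sg_classP u v : sg_class u = sg_class v <-> sg_cong u v.
Proof.
split=> [/eqmodP/asboolP //|uv].
by apply/eqmodP/asboolP.
Qed.

Definition sg_repr (a : structure_group) : word :=
  repr (a : {eq_quot sg_equiv}).

Fact sg_reprK a : sg_class (sg_repr a) = a.
Proof. exact: reprK. Qed.

Fact sg_class_repr u : sg_cong (sg_repr (sg_class u)) u.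
Proof. by apply/sg_classP; rewrite sg_reprK. Qed.

Definition word_inv (u : word) : word := rev [seq (~~ l.1, l.2) | l <- u].

Fact word_invK : involutive word_inv.
Proof.
move=> u; rewrite /word_inv map_rev revK -map_comp.
by rewrite (eq_map (g := id)) ?map_id // => -[b x] /=; rewrite negbK.
Qed.

Fact sg_cong_mulV u : sg_cong (word_inv u ++ u) [::].
Proof.
elim: u => [|[b x] u IHu]; first exact: sg_refl.
rewrite /word_inv /= rev_cons cat_rcons.
apply: (sg_trans (v := word_inv u ++ ([::] ++ u))) => //.
apply: sg_cat; first exact: sg_refl.
rewrite -[_ :: (b, x) :: u]/([:: (~~ b, x); (b, x)] ++ u).
apply: sg_cat; last exact: sg_refl.
by rewrite -{2}[b]negbK; apply: sg_cancel.
Qed.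

Fact sg_cong_mulVr u : sg_cong (u ++ word_inv u) [::].
Proof. by rewrite -{1}[u]word_invK; apply: sg_cong_mulV. Qed.

Fact sg_cong_inv u v : sg_cong u v -> sg_cong (word_inv u) (word_inv v).
Proof.
move=> uv; apply: (sg_trans (v := word_inv u ++ (v ++ word_inv v))).
  rewrite -{1}[word_inv u]cats0; apply: sg_cat; first exact: sg_refl.
  exact/sg_sym/sg_cong_mulVr.
rewrite catA -{2}[word_inv v]cat0s; apply: sg_cat; last exact: sg_refl.
apply: sg_trans (sg_cong_mulV u); apply: sg_cat; first exact: sg_refl.
exact: sg_sym.
Qed.

Definition sg_one : structure_group := sg_class [::].
Definition sg_mul (a b : structure_group) : structure_group :=
  sg_class (sg_repr a ++ sg_repr b).
Definition sg_inv (a : structure_group) : structure_group :=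
  sg_class (word_inv (sg_repr a)).

Fact sg_mulE u v : sg_mul (sg_class u) (sg_class v) = sg_class (u ++ v).
Proof. by apply/sg_classP; apply: sg_cat; apply: sg_class_repr. Qed.

Fact sg_invE u : sg_inv (sg_class u) = sg_class (word_inv u).
Proof. by apply/sg_classP/sg_cong_inv/sg_class_repr. Qed.

Fact sg_mulA : associative sg_mul.
Proof.
move=> a b c; rewrite -[a]sg_reprK -[b]sg_reprK -[c]sg_reprK.
by rewrite !sg_mulE catA.
Qed.

Fact sg_mul1 : left_id sg_one sg_mul.
Proof. by move=> a; rewrite -[a]sg_reprK sg_mulE. Qed.

Fact sg_mulr1 : right_id sg_one sg_mul.
Proof. by move=> a; rewrite -[a]sg_reprK sg_mulE cats0. Qed.

Fact sg_mulV : left_inverse sg_one sg_inv sg_mul.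
Proof.
move=> a; rewrite -[a]sg_reprK sg_invE sg_mulE.
exact/sg_classP/sg_cong_mulV.
Qed.

Fact sg_mulVr : right_inverse sg_one sg_inv sg_mul.
Proof.
move=> a; rewrite -[a]sg_reprK sg_invE sg_mulE.
exact/sg_classP/sg_cong_mulVr.
Qed.

HB.instance Definition _ := isGroup.Build structure_group
  sg_mulA sg_mul1 sg_mulr1 sg_mulV sg_mulVr.

Definition sg_gen (x : X) : structure_group := sg_class [:: (true, x)].

End StructureGroup.

(** * Garside theory *)

(* Every monoid considered is a submonoid of an ambient group [G], hence is
   cancellative; divisibility is always relative to the submonoid [M]. *)
Section Garside.
Variable G : groupType.
Implicit Types (A D M N : set G) (x y z m d : G).

Definition is_submonoid M : Prop :=
  M 1 /\ (forall x y, M x -> M y -> M (x * y)).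
Definition is_subgroup M : Prop :=
  is_submonoid M /\ (forall x, M x -> M x^-1).

Definition gen_monoid A : set G := smallest is_submonoid A.
Definition gen_subgroup A : set G := smallest is_subgroup A.

Definition ldivides M x z : Prop := exists2 t, M t & z = x * t.
Definition rdivides M x z : Prop := exists2 t, M t & z = t * x.

Definition ldivisors M z : set G := [set x | M x /\ ldivides M x z].
Definition rdivisors M z : set G := [set x | M x /\ rdivides M x z].

(* The right lcm is the lcm for left-divisibility, the left lcm that for
   right-divisibility; the left (right) gcd is the one for left
   (right) divisibility. *)
Definition is_right_lcm M x y m : Prop :=
  [/\ M m, ldivides M x m, ldivides M y m &
      forall m', M m' -> ldivides M x m' -> ldivides M y m' -> ldivides M m m'].
Definition is_left_lcm M x y m : Prop :=
  [/\ M m, rdivides M x m, rdivides M y m &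
      forall m', M m' -> rdivides M x m' -> rdivides M y m' -> rdivides M m m'].
Definition is_left_gcd M x y d : Prop :=
  [/\ M d, ldivides M d x, ldivides M d y &
      forall d', M d' -> ldivides M d' x -> ldivides M d' y -> ldivides M d' d].
Definition is_right_gcd M x y d : Prop :=
  [/\ M d, rdivides M d x, rdivides M d y &
      forall d', M d' -> rdivides M d' x -> rdivides M d' y -> rdivides M d' d].

Definition is_right_complement M x y z : Prop :=
  M z /\ is_right_lcm M x y (x * z).
Definition is_left_complement M x y z : Prop :=
  M z /\ is_left_lcm M x y (z * x).

Definition atoms M : set G :=
  [set x | [/\ M x, x <> 1
    & forall y z, M y -> M z -> x = y * z -> y = 1 \/ z = 1]].

Definition balanced M d : Prop := M d /\ ldivisors M d = rdivisors M d.

(* Div(d); only used for balanced d. *)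
Definition Div M d : set G := ldivisors M d.

Definition garside_element M d : Prop :=
  balanced M d /\ gen_monoid (Div M d) = M.

(* "The" Garside element: the minimal one. *)
Definition the_garside_element M d : Prop :=
  garside_element M d /\
  forall d', garside_element M d' -> ldivides M d' d -> d' = d.

Definition standard_parabolic_submonoid M N : Prop :=
  exists Delta delta,
    [/\ the_garside_element M Delta, balanced M delta, Div M Delta delta,
        gen_monoid (Div M delta) = N & N `&` Div M Delta = Div M delta].

(* Lcms and gcds in the lattice Div(Delta) are those of M, since Div(Delta) is
   closed under them. *)
Definition sublattice M D : Prop :=
  forall x y m, D x -> D y ->
    [/\ is_left_gcd M x y m -> D m, is_right_lcm M x y m -> D m,
        is_right_gcd M x y m -> D m & is_left_lcm M x y m -> D m].

Definition garside_submonoid M N : Prop :=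
  exists Delta, the_garside_element M Delta /\
  exists D : set G,
    [/\ D !=set0 /\ D `<=` Div M Delta,
        gen_monoid D = N,
        sublattice M D,
        (forall x y z, D x -> D y ->
           (is_right_complement M x y z -> D z) /\
           (is_left_complement M x y z -> D z))
      & (forall x y d, D x -> D y ->
           (is_left_gcd M (x * y) Delta d -> D d) /\
           (is_right_gcd M (x * y) Delta d -> D d))].

Definition atomic_submonoid M N : Prop := atoms N `<=` atoms M.

End Garside.

(** * Foldings *)

Section Foldings.
Variables (X : finType) (S : X * X -> X * X).
Notation G := (structure_group S).

Definition structure_monoid : set G := gen_monoid (range (sg_gen S)).
Notation M := structure_monoid.

Definition generated_subgroup (Y : {set X}) : set G :=
  gen_subgroup (sg_gen S @` [set` Y]).

Definition generates_atomic_garside (Y : {set X}) (d : G) : Prop :=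
  exists N : set G,
    [/\ garside_submonoid M N, atomic_submonoid M N,
        gen_subgroup N = generated_subgroup Y & the_garside_element N d].

Definition generates_standard_parabolic (Y : {set X}) : Prop :=
  exists2 N : set G, standard_parabolic_submonoid M N
    & gen_subgroup N = generated_subgroup Y.

(* [finset.partition] already demands that the blocks be nonempty. The
   bounds leave no proper partition when #|X| <= 2. *)
Definition proper_partition (P : {set {set X}}) : Prop :=
  finset.partition P [set: X]%SET /\ (1 < #|P| < #|X|)%N.

Definition complement_closed (X' : set G) : Prop :=
  forall a b z, X' a -> X' b -> a <> b ->
    (is_right_complement M a b z -> X' z) /\
    (is_left_complement M a b z -> X' z).

(* A set [X'] coerces to the type of its elements. At most one S' satisfies
   these conditions when X' is as in [folding_along]: non-degeneracy and
   involutivity settle the pairs (a, b) for which there is no such (c, d). *)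
Definition induced_solution (X' : set G) (S' : X' * X' -> X' * X') : Prop :=
  nondeg_symmetric_solution S' /\
  forall a b c d : X', a <> c ->
    val a * val b = val c * val d ->
    is_right_lcm M (val a) (val c) (val a * val b) ->
    S' (a, b) = (c, d).

Definition folding_along (P : {set {set X}})
    (X' : set G) (S' : X' * X' -> X' * X') : Prop :=
  proper_partition P /\
  exists Delta : {set X} -> G,
    [/\ (forall Y, Y \in P -> generates_atomic_garside Y (Delta Y)),
        X' = Delta @` [set` P],
        complement_closed X',
        (exists2 N : set G, garside_submonoid M N & atoms N = X')
      & induced_solution S'].

Definition strong_folding (X' : set G) (S' : X' * X' -> X' * X') : Prop :=
  exists2 P : {set {set X}}, folding_along P S'
    & forall Y, Y \in P -> generates_standard_parabolic Y.

End Foldings.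

(* Main.v *)
(* The letters act on X by z . x = g_x^-1 (z), and there is a cocycle
   weight : G -> Z^X, weight (a b) z = weight a z + weight b (z . a), sending a
   letter to its indicator. On the monoid M it is an isomorphism of posets from
   left divisibility onto the pointwise order of N^X, so lcms and gcds are
   pointwise. If A is stable under all g_x with x in A, the element delta A of
   weight 1_A is the Garside element of the parabolic submonoid of elements
   supported in A.

   For a decomposition X = Y + Z all the g_x preserve both blocks, delta Y and
   delta Z commute with product delta X, and they are the atoms of the Garside
   submonoid of elements whose weight is constant on Y and on Z.

   Conversely a standard parabolic submonoid is the submonoid of elements
   supported in some stable A. A Garside submonoid N is closed under left
   quotients and every element of the group it generates is d^-k v with d its
   Garside element and v in N; so N is determined by that group, and a block
   of a strong folding has Garside element delta A. Two such elements closed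
   under complements come from disjoint stable sets A and B covering X. *)
Require Import Defs.
From mathcomp Require Import all_boot.
From mathcomp Require Import boolp classical_sets cardinality.
From mathcomp Require Import order ssralg ssrnum ssrint zify.

Import GRing.Theory.

Set Implicit Arguments.
Unset Strict Implicit.
Unset Printing Implicit Defensive.

Local Open Scope classical_set_scope.
Local Open Scope ring_scope.
Local Open Scope group_scope.

(** * Sets with exactly two elements *)

Lemma card_eq2P (T : Type) (A : set T) :
  (A #= `I_2)%card <-> exists a b, a <> b /\ A = [set a; b].
Proof.
split=> [/eq_cardSP[a Aa /eq_cardSP[b [Ab ba]]]|[a [b [ab ->]]]].
  rewrite II0 card_eq0 => /eqP A0; exists a, b; split; first exact: nesym.
  apply/seteqP; split=> [c Ac|c [->|->//]//]; apply: contrapT => cab.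
  suff : ((A `\ a) `\ b) c by rewrite A0.
  by split; [split |] => // E; apply: cab; [left | right].
apply/eq_cardSP; exists a; first by left.
apply/eq_cardSP; exists b; first by split; [right | exact: nesym].
by rewrite II0 card_eq0; apply/eqP; rewrite -subset0 => c [[[|] + +]].
Qed.

(** * Submonoids with a Garside element *)

Section Generation.
Variable G : groupType.
Implicit Types (A N P : set G) (a b : G).

Lemma is_submonoid_gen A : is_submonoid (gen_monoid A).
Proof.
split=> [N [[N1 _] _] //|a b Ha Hb N HN].
by have [[_ NM] _] := HN; apply: NM; [apply: Ha | apply: Hb].
Qed.

Lemma is_subgroup_gen A : is_subgroup (gen_subgroup A).
Proof.
split=> [|a Ha N HN]; last by have [[_ NV] _] := HN; apply: NV; apply: Ha.
split=> [N [[[N1 _] _] _] //|a b Ha Hb N HN].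
by have [[[_ NM] _] _] := HN; apply: NM; [apply: Ha | apply: Hb].
Qed.

Lemma gen_monoid_min A N : is_submonoid N -> A `<=` N -> gen_monoid A `<=` N.
Proof. by move=> HN AN a; apply. Qed.

Lemma gen_subgroup_min A N : is_subgroup N -> A `<=` N -> gen_subgroup A `<=` N.
Proof. by move=> HN AN a; apply. Qed.

Lemma gen_monoid_incl A : A `<=` gen_monoid A.
Proof. by move=> a Aa N [_]; apply. Qed.

Lemma gen_subgroup_incl A : A `<=` gen_subgroup A.
Proof. by move=> a Aa N [_]; apply. Qed.

Lemma gen_subgroup_monoid A : gen_subgroup (gen_monoid A) = gen_subgroup A.
Proof.
apply/seteqP; split; apply: gen_subgroup_min; try exact: is_subgroup_gen.
  apply: gen_monoid_min (@gen_subgroup_incl A).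
  by have [] := is_subgroup_gen A.
by move=> a Aa; apply: gen_subgroup_incl; apply: gen_monoid_incl.
Qed.

Lemma gen_monoid_ind A P : P 1 ->
  (forall a b, A a -> gen_monoid A b -> P b -> P (a * b)) -> gen_monoid A `<=` P.
Proof.
move=> P1 PM a Aa.
(* [K] collects the elements whose left multiplication preserves [P]; it is a submonoid containing
   [A]. *)
pose K := [set a | gen_monoid A a /\
  forall b, gen_monoid A b -> P b -> P (a * b)].
have [gen1 genM] := is_submonoid_gen A.
suff /gen_monoid_min sAK : is_submonoid K.
  rewrite -[a]mulg1; have [|_] := sAK A _ a Aa; last exact.
  by move=> b Ab; split=> [|c]; [apply: gen_monoid_incl | apply: PM].
split=> [|b c [gb Kb] [gc Kc]]; first by split=> // b _; rewrite mul1g.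
split=> [|d gd Pd]; first exact: genM.
by rewrite -mulgA; apply: Kb; [apply: genM | apply: Kc].
Qed.

Section GarsideElement.
Variables (N : set G) (d : G).
Hypothesis gd : garside_element N d.

Lemma garside_element_submonoid : is_submonoid N.
Proof. by case: gd => _ <-; apply: is_submonoid_gen. Qed.

Lemma garside_element_mem : N d.
Proof. by case: gd => -[]. Qed.

Lemma garside_element_exp k : N (d ^+ k).
Proof.
have [N1 NM] := garside_element_submonoid.
elim: k => [|k IH]; first by rewrite expg0.
by rewrite expgS; apply: NM; first exact: garside_element_mem.
Qed.

Lemma garside_element_ind P : P 1 ->
  (forall s a, Div N d s -> N a -> P a -> P (s * a)) -> N `<=` P.
Proof. by case: gd => _ gend; rewrite -{2 3}gend; apply: gen_monoid_ind. Qed.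

Lemma Div_rdivides s : Div N d s -> exists t, Div N d t /\ d = t * s.
Proof.
case: gd => -[_ bal] _; rewrite /Div bal => -[Ns [t Nt E]]; exists t.
by rewrite -bal; split=> //; split=> //; exists s.
Qed.

(** For a divisor s write d = t s and then d = u t; hence d s = u t s = u d. So conjugation by d
    maps N into itself. *)
Lemma garside_element_conj a : N a -> exists b, N b /\ d * a = b * d.
Proof.
have [N1 NM] := garside_element_submonoid.
move: a; apply: garside_element_ind => [|s a Ds Na [b [Nb E]]].
  by exists 1; rewrite mulg1 mul1g.
have [t [Dt Et]] := Div_rdivides Ds; have [u [[Nu _] Eu]] := Div_rdivides Dt.
exists (u * b); split; first exact: NM.
by rewrite -mulgA -E {2}Et !mulgA -Eu.
Qed.

Lemma garside_element_expJ k a : N a -> exists b, N b /\ d ^+ k * a = b * d ^+ k.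
Proof.
elim: k a => [|k IH] a Na; first by exists a; rewrite expg0 mulg1 mul1g.
have [b [Nb Eb]] := IH a Na; have [c [Nc Ec]] := garside_element_conj Nb.
by exists c; rewrite !expgS -mulgA Eb !mulgA Ec.
Qed.

(** One power of d is spent on each divisor in a product; conjugation moves the cofactors to the
    left. *)
Lemma garside_element_cofinal a : N a -> exists k b, N b /\ d ^+ k = b * a.
Proof.
have [N1 NM] := garside_element_submonoid.
move: a; apply: garside_element_ind => [|s a Ds Na [k [b [Nb E]]]].
  by exists 0%N, 1; rewrite expg0 mulg1.
have [t [[Nt _] Et]] := Div_rdivides Ds; have [c [Nc Ec]] := garside_element_conj Nb.
exists k.+1, (c * t); split; first exact: NM.
by rewrite expgS E mulgA Ec {1}Et -!mulgA.
Qed.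

(** The fractions d^-k v with v in N form a subgroup: powers of d move past elements of N, and d^-k
    v is inverted by writing some d^l = c v, so that d^l (d^-k v)^-1 = c d^k. *)
Lemma gen_subgroup_fraction a : gen_subgroup N a -> exists k, N (d ^+ k * a).
Proof.
have [N1 NM] := garside_element_submonoid.
move: a; apply: gen_subgroup_min => [|a Na]; last first.
  by exists 0%N; rewrite expg0 mul1g.
split=> [|a [k Nka]].
  split=> [|a b [k Nka] [l Nlb]].
    by exists 0%N; rewrite expg0 mulg1.
  have [c [Nc Ec]] := garside_element_expJ l Nka.
  exists (l + k)%N; rewrite expgnDr -mulgA [d ^+ k * _]mulgA [d ^+ l * _]mulgA Ec.
  by rewrite -mulgA; apply: NM.
have [l [c [Nc Ec]]] := garside_element_cofinal Nka.
exists l; rewrite Ec !mulgA mulgK; apply: NM => //.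
exact: garside_element_exp.
Qed.

End GarsideElement.
End Generation.

(** * The weight cocycle *)

Section Weight.
Variables (X : finType) (S : X * X -> X * X).
Hypothesis solS : nondeg_symmetric_solution S.
Local Notation G := (structure_group S).
Local Notation M := (@structure_monoid X S).
Local Notation gen := (sg_gen S).
Local Notation g := (sol_g S).
Local Notation f := (sol_f S).

Lemma sol_g_inj x : injective (g x).
Proof. by case: solS => _ nd _; have [_ bij] := nd x; apply: bij_inj bij. Qed.

Lemma sol_f_inj x : injective (f x).
Proof. by case: solS => _ nd _; have [bij _] := nd x; apply: bij_inj bij. Qed.

Lemma sol_invol x y : S (g x y, f y x) = (x, y).
Proof. case: solS => _ _ [SK _]; rewrite -[RHS]SK /sol_g /sol_f; by case: (S (x, y)). Qed.

Lemma sol_ggf x y : g (g x y) (f y x) = x.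
Proof. by rewrite {1}/sol_g sol_invol. Qed.

(** First component of the braid relation. *)
Lemma sol_gg x y z : g x (g y z) = g (g x y) (g (f y x) z).
Proof.
case: solS => _ _ [_ /(_ (x, y, z))].
by move=> /(congr1 (fun p => p.1.1)) /=; rewrite /sol_g /sol_f => ->.
Qed.

(* A right action: x acts by the inverse of g_x. *)
Definition letter_act (l : bool * X) z :=
  if l.1 then finv (g l.2) z else g l.2 z.

(** The value on an inverse letter is forced by the cocycle rule applied to x^-1 x = 1. *)
Definition letter_weight (l : bool * X) z : int :=
  if l.1 then (z == l.2)%:Z else (- (g l.2 z == l.2)%:Z).

Definition word_act u z := foldl (fun z l => letter_act l z) z u.

Fixpoint word_weight u z : int :=
  if u is l :: u' then letter_weight l z + word_weight u' (letter_act l z)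
  else 0.

Lemma word_act_cat u v z : word_act (u ++ v) z = word_act v (word_act u z).
Proof. by rewrite /word_act foldl_cat. Qed.

Lemma word_weight_cat u v z :
  word_weight (u ++ v) z = word_weight u z + word_weight v (word_act u z).
Proof. elim: u z => [|l u IH] z /=; [lia | rewrite IH; lia]. Qed.

Lemma finv_g x z : finv (g x) (g x z) = z.
Proof. exact: finv_f (@sol_g_inj x) z. Qed.

Lemma g_finv x z : g x (finv (g x) z) = z.
Proof. exact: f_finv (@sol_g_inj x) z. Qed.

Lemma letter_act2 x y z :
  word_act [:: (true, x); (true, y)] (g x (g y z)) = z.
Proof. by rewrite /word_act /= /letter_act /= !finv_g. Qed.

(** On a relator the actions agree by [sol_gg]. The word x y has weight 1_x + 1_{g x y}; the other
    side has 1_{g x y} plus the indicator of g (g x y) (f y x), which is x by [sol_ggf]. *)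
Lemma sg_cong_act_weight u v : sg_cong S u v ->
  word_act u =1 word_act v /\ word_weight u =1 word_weight v.
Proof.
elim=> {u v} [//|u v _ [h1 h2]|u v w _ [h1 h2] _ [h3 h4]
  |u u' v v' _ [h1 h2] _ [h3 h4]|b x|x y].
- by split=> z; rewrite (h1, h2).
- by split=> z; rewrite (h1, h2) (h3, h4).
- by split=> z; rewrite ?word_act_cat ?word_weight_cat ?h1 ?h2 ?h3 ?h4.
- split=> z; case: b; rewrite /word_act /= /letter_act /letter_weight /=
    ?finv_g ?g_finv //; lia.
- have E z : z = g x (g y (word_act [:: (true, x); (true, y)] z)).
    by rewrite /word_act /= /letter_act /= !g_finv.
  split=> z; first by rewrite [in RHS](E z) sol_gg letter_act2.
  rewrite /= /letter_act /letter_weight /=.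
  have H a b c : (finv (g a) b == c) = (b == g a c).
    by apply/eqP/eqP=> [<-|->]; rewrite ?g_finv ?finv_g.
  rewrite !H sol_ggf; lia.
Qed.

Definition sg_act (a : G) := word_act (sg_repr a).

Definition weight (a : G) := word_weight (sg_repr a).

Lemma sg_actE u : sg_act (sg_class S u) =1 word_act u.
Proof. exact: (sg_cong_act_weight (sg_class_repr S u)).1. Qed.

Lemma weightE u : weight (sg_class S u) =1 word_weight u.
Proof. exact: (sg_cong_act_weight (sg_class_repr S u)).2. Qed.

Lemma sg_act1 z : sg_act 1 z = z.
Proof. exact: sg_actE. Qed.

Lemma sg_actM a b z : sg_act (a * b) z = sg_act b (sg_act a z).
Proof. by rewrite -[a]sg_reprK -[b]sg_reprK [_ * _]sg_mulE !sg_actE word_act_cat. Qed.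

Lemma sg_act_inj a : injective (sg_act a).
Proof.
by apply: (can_inj (g := sg_act a^-1)) => z; rewrite -sg_actM mulgV sg_act1.
Qed.

Lemma sg_act_surj a z : exists w, z = sg_act a w.
Proof. by exists (sg_act a^-1 z); rewrite -sg_actM mulVg sg_act1. Qed.

Lemma weight1 z : weight 1 z = 0.
Proof. exact: weightE. Qed.

Lemma weightM a b z : weight (a * b) z = weight a z + weight b (sg_act a z).
Proof.
by rewrite -[a]sg_reprK -[b]sg_reprK [_ * _]sg_mulE sg_actE !weightE word_weight_cat.
Qed.

Lemma sg_act_gen x y : sg_act (gen x) (g x y) = y.
Proof. by rewrite sg_actE; apply: finv_g. Qed.

Lemma sol_g_act x z : g x (sg_act (gen x) z) = z.
Proof. by rewrite sg_actE; apply: g_finv. Qed.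

Lemma weight_gen x z : weight (gen x) z = (z == x)%:Z.
Proof. by rewrite weightE /= /letter_weight /=; lia. Qed.

Lemma gen_relator x y : gen x * gen y = gen (g x y) * gen (f y x).
Proof. by rewrite [LHS]sg_mulE [RHS]sg_mulE; apply/sg_classP/sg_relator. Qed.

(** * Left divisibility in the structure monoid *)

Lemma monoid1 : M 1.
Proof. by have [] := is_submonoid_gen (range gen). Qed.

Lemma monoidM a b : M a -> M b -> M (a * b).
Proof. by have [_] := is_submonoid_gen (range gen); apply. Qed.

Lemma monoid_gen x : M (gen x).
Proof. by apply: gen_monoid_incl; exists x. Qed.

Lemma monoid_ind (P : set G) : P 1 ->
  (forall x b, M b -> P b -> P (gen x * b)) -> M `<=` P.
Proof. by move=> P1 PM; apply: gen_monoid_ind => // _ b [x _ <-]; apply: PM. Qed.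

Lemma weight_ge0 a z : M a -> 0 <= weight a z.
Proof.
move=> Ma; move: a Ma z; apply: monoid_ind => [|x b _ IH] z.
  by rewrite weight1.
by rewrite weightM weight_gen; move: (IH (sg_act (gen x) z)); lia.
Qed.

(** If a starts with y different from x, then by induction the rest starts with z = g_y^-1 (x), and
    the relation y z = x f_z (y) brings x to the front. *)
Lemma monoid_head a x : M a -> 0 < weight a x -> exists2 b, M b & a = gen x * b.
Proof.
move=> Ma; move: a Ma x; apply: monoid_ind => [|y b Mb IH] x.
  by rewrite weight1.
rewrite weightM weight_gen; have [->|ne] := eqVneq x y; first by exists b.
rewrite add0r => /IH[c Mc ->]; set z := sg_act _ _.
have gyz : g y z = x by exact: sol_g_act.
exists (gen (f z y) * c); first exact: monoidM (monoid_gen _) Mc.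
by rewrite !mulgA gen_relator gyz.
Qed.

Lemma weight_eq0 a : M a -> (forall z, weight a z = 0) -> a = 1.
Proof.
have [] := EM (a = 1) => // a1 Ma a0; move: a Ma a1 a0.
apply: monoid_ind => // x b Mb _ _ /(_ x).
by rewrite weightM weight_gen eqxx; have := weight_ge0 (sg_act (gen x) x) Mb; lia.
Qed.

(** Conversely, the first letter x of a has positive weight in b, so b starts with x too; cancelling
    x translates the remaining weights by the same permutation. *)
Lemma ldividesP a b : M a -> M b ->
  ldivides M a b <-> forall z, weight a z <= weight b z.
Proof.
move=> Ma Mb; split=> [[t Mt ->] z|].
  by rewrite weightM; have := weight_ge0 (sg_act a z) Mt; lia.
move: a Ma b Mb; apply: monoid_ind => [|x a Ma IH] b Mb le_ab.
  by exists b; rewrite ?mul1g.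
have [|c Mc Eb] := @monoid_head b x Mb.
  move: (le_ab x); rewrite weightM weight_gen eqxx.
  by have := weight_ge0 (sg_act (gen x) x) Ma; lia.
have [|t Mt Ec] := IH c Mc.
  move=> z; have [w ->] := sg_act_surj (gen x) z.
  by move: (le_ab w); rewrite Eb !weightM; lia.
by exists t; rewrite // Eb Ec mulgA.
Qed.

Lemma weight_inj a b : M a -> M b -> weight a =1 weight b -> a = b.
Proof.
move=> Ma Mb E; have [|t Mt Eb] := (ldividesP Ma Mb).2.
  by move=> z; rewrite E.
suff t1 : t = 1 by rewrite Eb t1 mulg1.
apply: weight_eq0 => // z; have [w ->] := sg_act_surj a z.
by move: (E w); rewrite Eb weightM; lia.
Qed.

Lemma exists_weight (v : X -> nat) :
  exists2 a, M a & forall z, weight a z = v z.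
Proof.
move: {2}(\sum_z v z)%N (leqnn (\sum_z v z)%N) => n.
elim: n v => [|n IH] v.
  rewrite leqn0 sum_nat_eq0 => /forallP v0; exists 1; first exact: monoid1.
  by move=> z; rewrite weight1; have /eqP -> := v0 z.
have [/existsP[x vx]|] := boolP [exists x, (0 < v x)%N]; last first.
  rewrite negb_exists => /forallP v0 _; exists 1; first exact: monoid1.
  by move=> z; rewrite weight1; have := v0 z; lia.
rewrite (bigD1 x) //= => le_v.
have [|a Ma Ea] := IH (fun z => v z - (z == x))%N.
  rewrite (bigD1 x) //= eqxx (eq_bigr v); first lia.
  by move=> z /negbTE ->; rewrite subn0.
(* Since [sg_act a] is injective, appending the letter x . a adds exactly the indicator of x. *)
exists (a * gen (sg_act a x)); first exact: monoidM Ma (monoid_gen _).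
move=> z; rewrite weightM weight_gen Ea (inj_eq (@sg_act_inj a)).
by have [->|_] := eqVneq z x; lia.
Qed.

(** * Lcms and gcds for left divisibility *)

Lemma weight_right_lcm a b m z : M a -> M b -> is_right_lcm M a b m ->
  weight m z = Num.max (weight a z) (weight b z).
Proof.
move=> Ma Mb [Mm /(ldividesP Ma Mm) le_am /(ldividesP Mb Mm) le_bm min_m].
(* The element whose weight is the pointwise maximum is a common multiple, so minimality of m bounds
   m by it. Absolute values only convert nonnegative integers to naturals. *)
have [c Mc Ec] := exists_weight (fun z => maxn `|weight a z|%N `|weight b z|%N).
have {}Ec w : weight c w = Num.max (weight a w) (weight b w).
  by rewrite Ec; have := weight_ge0 w Ma; have := weight_ge0 w Mb; lia.
have /(ldividesP Mm Mc)/(_ z) : ldivides M m c.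
  by apply: min_m => //; [apply/(ldividesP Ma Mc) | apply/(ldividesP Mb Mc)]
     => w; rewrite Ec; lia.
by move: (le_am z) (le_bm z); rewrite Ec; lia.
Qed.

Lemma weight_left_gcd a b d z : M a -> M b -> is_left_gcd M a b d ->
  weight d z = Num.min (weight a z) (weight b z).
Proof.
move=> Ma Mb [Md /(ldividesP Md Ma) le_da /(ldividesP Md Mb) le_db max_d].
have [c Mc Ec] := exists_weight (fun z => minn `|weight a z|%N `|weight b z|%N).
have {}Ec w : weight c w = Num.min (weight a w) (weight b w).
  by rewrite Ec; have := weight_ge0 w Ma; have := weight_ge0 w Mb; lia.
have /(ldividesP Mc Md)/(_ z) : ldivides M c d.
  by apply: max_d => //; [apply/(ldividesP Mc Ma) | apply/(ldividesP Mc Mb)]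
     => w; rewrite Ec; lia.
by move: (le_da z) (le_db z); rewrite Ec; lia.
Qed.

Lemma exists_right_lcm a b : M a -> M b -> exists p q,
  [/\ M p, M q, a * p = b * q & is_right_lcm M a b (a * p)].
Proof.
move=> Ma Mb.
have [c Mc Ec] := exists_weight (fun z => maxn `|weight a z|%N `|weight b z|%N).
have {}Ec w : weight c w = Num.max (weight a w) (weight b w).
  by rewrite Ec; have := weight_ge0 w Ma; have := weight_ge0 w Mb; lia.
have ac : ldivides M a c by apply/ldividesP => // w; rewrite Ec; lia.
have bc : ldivides M b c by apply/ldividesP => // w; rewrite Ec; lia.
have [[p Mp Ep] [q Mq Eq]] := (ac, bc).
exists p, q; rewrite -Ep -Eq; split=> //; split=> // m Mm.
move=> /(ldividesP Ma Mm) le_am /(ldividesP Mb Mm) le_bm.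
by apply/ldividesP => // w; move: (le_am w) (le_bm w); rewrite Ec; lia.
Qed.

(** * Letters as atoms *)

Lemma gen_neq1 x : gen x <> 1.
Proof. by move=> /(congr1 (fun a => weight a x)); rewrite weight1 weight_gen eqxx. Qed.

Lemma exists_weight_gt0 a : M a -> a <> 1 -> exists z, 0 < weight a z.
Proof.
move=> Ma; apply: contra_notP => a0; apply: weight_eq0 => // z.
apply/eqP; apply: contra_notT a0 => az; exists z.
by have := weight_ge0 z Ma; lia.
Qed.

(** Two nontrivial factors would each contribute positive weight; both contributions fall at x,
    where only 1 is available. *)
Lemma gen_factor x a b : M a -> M b -> gen x = a * b -> a = 1 \/ b = 1.
Proof.
move=> Ma Mb E; have [a1|a1] := EM (a = 1); first by left.
have [b1|b1] := EM (b = 1); [by right | exfalso].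
have W z : (z == x)%:Z = weight a z + weight b (sg_act a z).
  by rewrite -weight_gen E weightM.
have [[z az] [w bw]] := (exists_weight_gt0 Ma a1, exists_weight_gt0 Mb b1).
have [u Eu] := sg_act_surj a w; move: bw; rewrite Eu => bu.
have zx : z = x.
  move: (W z); have := weight_ge0 (sg_act a z) Mb; move: az.
  by case: eqVneq => // _; lia.
have ux : u = x.
  by move: (W u) bu; have := weight_ge0 u Ma; case: eqVneq => // _; lia.
by move: (W x) az bu; rewrite zx ux eqxx; lia.
Qed.

(** An atom can be a product of elements of [D] only by being one of them. *)
Lemma gen_monoid_gen (D : set G) x : D `<=` M -> gen_monoid D (gen x) ->
  D (gen x).
Proof.
move=> DM; pose K := [set a | M a /\ forall y, a = gen y -> D a].
suff /gen_monoid_min KD : is_submonoid K.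
  move=> Dx; have [|_] := KD D _ _ Dx; last by move/(_ x); apply.
  by move=> a Da; split=> [|//]; apply: DM.
split=> [|a b [Ma Da] [Mb Db]].
  by split=> [|y /esym/gen_neq1 //]; apply: monoid1.
split=> [|y E]; first exact: monoidM.
have [a1|b1] := gen_factor Ma Mb (esym E).
  by move: E; rewrite a1 mul1g => /Db.
by move: E; rewrite b1 mulg1 => /Da.
Qed.

(** * Submonoids supported in a stable set *)

(** The equality also gives invariance under g_x^-1; as X is finite, forward closure is enough
    ([closed_stable]). *)
Definition stable (A : {set X}) := forall x y, x \in A -> (g x y \in A) = (y \in A).

Definition supported (A : {set X}) : set G :=
  [set a | M a /\ forall z, z \notin A -> weight a z = 0].

Definition delta (A : {set X}) : G :=
  sval (cid2 (exists_weight (fun z => z \in A))).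

Lemma monoid_delta A : M (delta A).
Proof. by rewrite /delta; case: cid2. Qed.

Lemma weight_delta A z : weight (delta A) z = (z \in A)%:Z.
Proof. by rewrite /delta; case: cid2. Qed.

Lemma delta_inj : injective delta.
Proof.
move=> A B E; apply/setP => z; move: (weight_delta A z).
by rewrite E weight_delta; case: (z \in A) (z \in B) => [] [].
Qed.

Lemma supportedT : supported [set: X] = M.
Proof. by apply/seteqP; split=> a => [[]//|Ma]; split=> // z; rewrite inE. Qed.

Lemma stableT : stable [set: X].
Proof. by move=> x y _; rewrite !inE. Qed.

Lemma supported_delta A : supported A (delta A).
Proof.
by split=> [|z /negbTE Az]; [apply: monoid_delta | rewrite weight_delta Az].
Qed.

Section Stable.
Variable A : {set X}.
Hypothesis stA : stable A.

Lemma stable_act_gen x y : x \in A -> (sg_act (gen x) y \in A) = (y \in A).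
Proof. by move=> Ax; rewrite -{2}(sol_g_act x y) stA. Qed.

Lemma supported_gen_mul x b : M b -> supported A (gen x * b) ->
  x \in A /\ supported A b.
Proof.
move=> Mb [_ sxb]; have W z := weightM (gen x) b z.
have Ax : x \in A.
  apply: contraT => /sxb; rewrite W weight_gen eqxx.
  by have := weight_ge0 (sg_act (gen x) x) Mb; lia.
split=> //; split=> // z.
have [w ->] := sg_act_surj (gen x) z; rewrite stable_act_gen // => /sxb.
by rewrite W weight_gen; have := weight_ge0 (sg_act (gen x) w) Mb; lia.
Qed.

Lemma supported_ind (P : set G) : P 1 ->
  (forall x b, x \in A -> supported A b -> P b -> P (gen x * b)) ->
  supported A `<=` P.
Proof.
move=> P1 PM a [Ma]; move: a Ma.
apply: (@monoid_ind (fun a => _ -> P a)) => [//|x b Mb IH sxb].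
have [Ax [_ sb]] : x \in A /\ supported A b.
  by apply: supported_gen_mul => //; split=> //; apply: monoidM (monoid_gen _) Mb.
by apply: PM => //; apply: IH.
Qed.

Lemma supported_act a z : supported A a -> (sg_act a z \in A) = (z \in A).
Proof.
move=> sa; move: a sa z; apply: supported_ind => [|x b Ax _ IH] z.
  by rewrite sg_act1.
by rewrite sg_actM IH stable_act_gen.
Qed.

Lemma supported_submonoid : is_submonoid (supported A).
Proof.
split; first by split=> [|z _]; rewrite ?weight1; first exact: monoid1.
move=> a b sa sb; have [[Ma a0] [Mb b0]] := (sa, sb).
split=> [|z Az]; first exact: monoidM.
by rewrite weightM a0 // b0 ?supported_act.
Qed.

Lemma supported_gen x : x \in A -> supported A (gen x).
Proof.
move=> Ax; split=> [|z Az]; first exact: monoid_gen.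
by rewrite weight_gen; have [zx|//] := eqVneq z x; rewrite zx Ax in Az.
Qed.

Lemma supportedE : supported A = gen_monoid (gen @` [set` A]).
Proof.
have [gen1 genM] := is_submonoid_gen (gen @` [set` A]).
apply/seteqP; split.
  apply: supported_ind => // x b Ax _; apply: genM.
  by apply: gen_monoid_incl; exists x.
apply: gen_monoid_min supported_submonoid _ => _ [x Ax <-].
exact: supported_gen.
Qed.

(** Weights in M are nonnegative, so both terms of the cocycle formula vanish wherever the sum does;
    once a is supported, it maps the complement of A onto itself, which settles b. *)
Lemma supported_factor a b : M a -> M b -> supported A (a * b) ->
  supported A a /\ supported A b.
Proof.
move=> Ma Mb [_ sab].
have sa : supported A a.
  split=> // z /sab; rewrite weightM.
  by have := weight_ge0 (sg_act a z) Mb; have := weight_ge0 z Ma; lia.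
split=> //; split=> // z; have [w ->] := sg_act_surj a z.
rewrite supported_act // => /sab; rewrite weightM.
by have := weight_ge0 (sg_act a w) Mb; have := weight_ge0 w Ma; lia.
Qed.

(* [y := sg_act (gen x) x] is g_x^-1 (x); then S fixes (x, y), so f_y (x) = y. *)
Lemma diagonal_inj : injective (fun x => sg_act (gen x) x).
Proof.
have E x : S (x, sg_act (gen x) x) = (x, sg_act (gen x) x).
  set y := sg_act _ _.
  have gxy : g x y = x by exact: sol_g_act.
  have /(@sol_g_inj x) fyx : g x (f y x) = g x y by rewrite -{1}gxy sol_ggf.
  by rewrite [LHS]surjective_pairing; congr pair; [apply: gxy | apply: fyx].
move=> x y /= Exy; apply: (@sol_f_inj (sg_act (gen x) x)).
by rewrite {1}/sol_f E {2}Exy /sol_f E /= Exy.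
Qed.

(* Letters of A are prepended to a until the weight is full: since x |-> g_x^-1 (x)
   permutes A, a missing point w is g_y^-1 (y) for some y in A, and y a still
   has weight at most 1_A. *)
Lemma rdivides_delta a : M a -> (forall z, weight a z <= (z \in A)%:Z) ->
  rdivides M a (delta A).
Proof.
pose zeros a := [set z in A | weight a z == 0]%SET.
move: {2}#|zeros a| (leqnn #|zeros a|) => n.
elim: n a => [|n IH] a; rewrite ?leqn0 => zn Ma le_a.
  exists 1; rewrite ?mul1g; first exact: monoid1.
  apply: weight_inj => [||z] //; first exact: monoid_delta.
  move: zn; rewrite cards_eq0 => /eqP/setP/(_ z); rewrite !inE weight_delta.
  by have := le_a z; have := weight_ge0 z Ma; lia.
have [z0|] := eqVneq (zeros a) finset.set0.
  by apply: IH => //; rewrite z0 cards0.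
case/set0Pn=> w /[dup] zw; rewrite inE => /andP[Aw /eqP aw].
have /eqP TA : ((fun x => sg_act (gen x) x) @: A == A)%SET.
  rewrite eqEcard card_imset ?leqnn ?andbT; last exact: diagonal_inj.
  by apply/fintype.subsetP => _ /imsetP[x Ax ->]; rewrite /= stable_act_gen.
move: Aw; rewrite -{1}TA => /imsetP[y Ay Ew].
have Mya : M (gen y * a) by apply: monoidM (monoid_gen _) Ma.
have W z : weight (gen y * a) z = (z == y)%:Z + weight a (sg_act (gen y) z).
  by rewrite weightM weight_gen.
have [|//|z|t Mt E] := IH (gen y * a).
- rewrite -ltnS; apply: leq_trans zn.
  rewrite (cardsD1 w (zeros a)) zw ltnS -(card_imset _ (@sg_act_inj (gen y))).
  apply/subset_leq_card/fintype.subsetP => _ /imsetP[z + ->].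
  rewrite !inE W stable_act_gen // => /andP[-> az] /=.
  have := weight_ge0 (sg_act (gen y) z) Ma.
  by rewrite Ew (inj_eq (@sg_act_inj (gen y))); lia.
- rewrite W; have [->|_] := eqVneq z y; first by rewrite -Ew aw Ay.
  by rewrite add0r -(stable_act_gen z Ay); apply: le_a.
by exists (t * gen y); [apply: monoidM Mt (monoid_gen _) | rewrite E mulgA].
Qed.

(** * Divisors and Garside element of a parabolic submonoid *)

Lemma DivE d : M d -> Div M d = [set a | M a /\ forall z, weight a z <= weight d z].
Proof.
move=> Md; apply/seteqP; split=> a [Ma le_a]; split=> //.
  exact/ldividesP.
exact/ldividesP.
Qed.

Lemma Div_delta :
  Div M (delta A) = [set a | M a /\ forall z, weight a z <= (z \in A)%:Z].
Proof.
rewrite DivE; last exact: monoid_delta.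
by apply/seteqP; split=> a [Ma le_a]; split=> // z; move: (le_a z);
  rewrite weight_delta.
Qed.

(** If [delta A] = t a, then t is supported in A and permutes A, so the translate of 1_A that bounds
    the weight of a is 1_A itself. The other inclusion is [rdivides_delta]. *)
Lemma rdivisors_delta : rdivisors M (delta A) = Div M (delta A).
Proof.
rewrite Div_delta; apply/seteqP; split=> a [Ma]; last first.
  by move=> le_a; split=> //; apply: rdivides_delta.
case=> t Mt E; split=> // z; have [w ->] := sg_act_surj t z.
have [st _] : supported A t /\ supported A a.
  by apply: supported_factor => //; rewrite -E; apply: supported_delta.
have := weight_delta A w; rewrite E weightM supported_act //.
by have := weight_ge0 w Mt; lia.
Qed.

Lemma delta_balanced : balanced M (delta A).
Proof. by split; [apply: monoid_delta | rewrite rdivisors_delta]. Qed.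

Lemma supported_ldivisors d : supported A d ->
  ldivisors (supported A) d = ldivisors M d.
Proof.
move=> sd; apply/seteqP; split=> a [].
  by move=> [Ma _] [t [Mt _] E]; split=> //; exists t.
move=> Ma [t Mt E]; have [sa st] : supported A a /\ supported A t.
  by apply: supported_factor => //; rewrite -E.
by split=> //; exists t.
Qed.

Lemma supported_rdivisors d : supported A d ->
  rdivisors (supported A) d = rdivisors M d.
Proof.
move=> sd; apply/seteqP; split=> a [].
  by move=> [Ma _] [t [Mt _] E]; split=> //; exists t.
move=> Ma [t Mt E]; have [st sa] : supported A t /\ supported A a.
  by apply: supported_factor => //; rewrite -E.
by split=> //; exists t.
Qed.

Lemma Div_delta_gen x : x \in A -> Div M (delta A) (gen x).
Proof.
move=> Ax; rewrite Div_delta; split=> [|z]; first exact: monoid_gen.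
by rewrite weight_gen; have [->|_] := eqVneq z x; rewrite ?Ax.
Qed.

Lemma gen_Div_delta : gen_monoid (Div M (delta A)) = supported A.
Proof.
have [gen1 genM] := is_submonoid_gen (Div M (delta A)).
apply/seteqP; split.
  apply: gen_monoid_min supported_submonoid _ => a; rewrite Div_delta.
  move=> [Ma le_a]; split=> // z Az; have := le_a z.
  by rewrite (negbTE Az); have := weight_ge0 z Ma; lia.
apply: supported_ind => // x b Ax _; apply: genM.
by apply: gen_monoid_incl; apply: Div_delta_gen.
Qed.

(** The divisors of d generate all letters of A, which are atoms; so each of these letters divides
    d. *)
Lemma garside_element_supported d : garside_element (supported A) d ->
  forall z, (z \in A)%:Z <= weight d z.
Proof.
move=> [[[Md sd] _] gend] z; have [Az|_] := boolP (z \in A); last exact: weight_ge0.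
have : gen_monoid (Div (supported A) d) (gen z).
  by rewrite gend; apply: supported_gen.
move=> /gen_monoid_gen[a [] []//|_ [t [Mt _] ->]].
by rewrite weightM weight_gen eqxx; have := weight_ge0 (sg_act (gen z) z) Mt; lia.
Qed.

Lemma the_garside_supported : the_garside_element (supported A) (delta A).
Proof.
have sd := supported_delta A; split.
  split; last by rewrite /Div supported_ldivisors ?gen_Div_delta.
  split=> //; rewrite supported_ldivisors // supported_rdivisors //.
  by case: delta_balanced.
move=> d /[dup] gd /garside_element_supported ge_d [t [Mt _] E].
have [[[Md _] _] _] := gd.
apply: weight_inj => // [|z]; first exact: monoid_delta.
have := ge_d z; rewrite -weight_delta E weightM.
by have := weight_ge0 (sg_act d z) Mt; lia.
Qed.

(** [delta A] divides every Garside element, so minimality of d forces equality. *)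
Lemma the_garside_supported_unique d :
  the_garside_element (supported A) d -> d = delta A.
Proof.
move=> [gd min_d]; have [gA _] := the_garside_supported.
apply/esym/min_d => //; have [sd _] := gd.
have: ldivisors (supported A) d (delta A).
  rewrite supported_ldivisors; last by case: sd.
  split; first exact: monoid_delta.
  apply/ldividesP; [exact: monoid_delta | by case: sd => -[] |].
  by move=> z; rewrite weight_delta; apply: garside_element_supported.
by case.
Qed.

Lemma atomic_supported : atomic_submonoid M (supported A).
Proof.
move=> a [sa a1 fa]; split=> // [|y z My Mz E]; first by case: sa.
have [sy sz] : supported A y /\ supported A z by apply: supported_factor; rewrite -?E.
exact: fa.
Qed.

Lemma gen_subgroup_supported : gen_subgroup (supported A) = @generated_subgroup X S A.
Proof. by rewrite supportedE gen_subgroup_monoid. Qed.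

End Stable.

(** * Parabolic submonoids inside the structure monoid *)

Lemma the_garside_monoid : the_garside_element M (delta [set: X]).
Proof. by rewrite -supportedT; apply/the_garside_supported/stableT. Qed.

Lemma the_garside_monoid_unique d : the_garside_element M d -> d = delta [set: X].
Proof. by rewrite -supportedT; apply/the_garside_supported_unique/stableT. Qed.

Lemma Div_DeltaP a : Div M (delta [set: X]) a <-> M a /\ forall z, weight a z <= 1%:Z.
Proof.
by rewrite Div_delta; split=> -[Ma le_a]; split=> // z;
  have := le_a z; rewrite inE.
Qed.

Lemma Div_delta_sub A : Div M (delta A) `<=` Div M (delta [set: X]).
Proof.
move=> a; rewrite Div_delta => -[Ma le_a]; apply/Div_DeltaP; split=> // z.
by apply: Order.POrderTheory.le_trans (le_a z) _; case: (z \in A).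
Qed.

Lemma Div_supported A : stable A ->
  supported A `&` Div M (delta [set: X]) = Div M (delta A).
Proof.
move=> stA; apply/seteqP; split=> [a [[Ma a0]] /Div_DeltaP[_ le_a]|a Da].
  rewrite Div_delta; split=> // z; have := le_a z.
  by case: (boolP (z \in A)) => // /a0 ->.
split; last exact: Div_delta_sub Da.
by rewrite -gen_Div_delta //; apply: gen_monoid_incl.
Qed.

Lemma standard_parabolic_supported A : stable A ->
  standard_parabolic_submonoid M (supported A).
Proof.
move=> stA; exists (delta [set: X]), (delta A); split.
- exact: the_garside_monoid.
- exact: delta_balanced.
- by apply: (@Div_delta_sub A); split; [exact: monoid_delta | exists 1;
    [exact: monoid1 | rewrite mulg1]].
- exact: gen_Div_delta.
- exact: Div_supported.
Qed.

Lemma Div_ldivides d a b : M a -> ldivides M a b -> Div M d b -> Div M d a.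
Proof.
move=> Ma [t Mt ->] [_ [u Mu E]]; split=> //.
by exists (t * u); [exact: monoidM | rewrite E mulgA].
Qed.

Lemma Div_delta_rdivides A : stable A -> forall a b,
  M a -> rdivides M a b -> Div M (delta A) b -> Div M (delta A) a.
Proof.
move=> stA a b; rewrite -rdivisors_delta // => Ma [t Mt ->] [_ [u Mu E]].
by split=> //; exists (u * t); [exact: monoidM | rewrite E mulgA].
Qed.

(** The generating set is [Div M (delta A)]. It contains lcms because [delta A] is a common
    multiple, and gcds and complements because they divide its elements. A gcd of x y with the
    Garside element is supported in A and divides that element, so [Div_supported] applies. *)
Lemma garside_supported A : stable A -> garside_submonoid M (supported A).
Proof.
move=> stA; exists (delta [set: X]); split; first exact: the_garside_monoid.
have [Dldiv Drdiv] := (@Div_ldivides (delta A), Div_delta_rdivides stA).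
have DM a : Div M (delta A) a -> M a by case.
have Dlcm x y m : Div M (delta A) x -> Div M (delta A) y ->
    is_right_lcm M x y m -> Div M (delta A) m.
  move=> [Mx dx] [My dy] [Mm _ _ min_m]; split=> //.
  by apply: min_m => //; apply: monoid_delta.
have Dllcm x y m : Div M (delta A) x -> Div M (delta A) y ->
    is_left_lcm M x y m -> Div M (delta A) m.
  rewrite -rdivisors_delta // => -[Mx dx] [My dy] [Mm _ _ min_m]; split=> //.
  by apply: min_m => //; apply: monoid_delta.
exists (Div M (delta A)); split.
- split; last exact: Div_delta_sub.
  exists (delta A); split; first exact: monoid_delta.
  by exists 1; [exact: monoid1 | rewrite mulg1].
- exact: gen_Div_delta.
- move=> x y m Dx Dy; split.
  + by move=> [Mm mx _ _]; apply: Dldiv mx Dx.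
  + exact: Dlcm.
  + by move=> [Mm mx _ _]; apply: Drdiv mx Dx.
  + exact: Dllcm.
- move=> x y z Dx Dy; split=> -[Mz].
  + move=> /(Dlcm _ _ _ Dx Dy); apply: Drdiv => //.
    by exists x; [exact: DM |].
  + move=> /(Dllcm _ _ _ Dx Dy); apply: Dldiv => //.
    by exists x; [exact: DM |].
- move=> x y d Dx Dy.
  have sxy : supported A (x * y).
    have [_ sM] := supported_submonoid stA.
    by apply: sM; rewrite -gen_Div_delta //; apply: gen_monoid_incl.
  rewrite -Div_supported //; split=> -[Md [t Mt E] dD _]; rewrite E in sxy.
    have [sd _] := supported_factor stA Md Mt sxy.
    by split=> //; split.
  have [_ sd] := supported_factor stA Mt Md sxy.
  by split=> //; rewrite -rdivisors_delta //; apply: stableT.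
Qed.

Lemma generates_atomic_garside_delta A : stable A ->
  @generates_atomic_garside X S A (delta A).
Proof.
move=> stA; exists (supported A); split.
- exact: garside_supported.
- exact: atomic_supported.
- exact: gen_subgroup_supported.
- exact: the_garside_supported.
Qed.

Lemma generates_standard_parabolic_stable A : stable A ->
  @generates_standard_parabolic X S A.
Proof.
move=> stA; exists (supported A); first exact: standard_parabolic_supported.
exact: gen_subgroup_supported.
Qed.

(** * Stable and invariant subsets *)

Lemma closed_stable (A : {set X}) :
  (forall x y, x \in A -> y \in A -> g x y \in A) -> stable A.
Proof.
move=> cA x y Ax; have /eqP gA : (g x @: A == A)%SET.
  rewrite eqEcard card_imset ?leqnn ?andbT; last exact: sol_g_inj.
  by apply/fintype.subsetP => _ /imsetP[z Az ->]; apply: cA.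
by rewrite -{1}gA mem_imset //; apply: sol_g_inj.
Qed.

Lemma invariant_stable A : invariant_subset S A -> stable A.
Proof.
by move=> invA; apply: closed_stable => x y Ax Ay; have [] := invA (x, y) Ax Ay.
Qed.

Lemma stable_nondeg_invariant A : stable A -> nondeg_invariant_subset S A.
Proof.
move=> stA; have invA : invariant_subset S A.
  move=> [x y] /= Ax Ay; have Ag : g x y \in A by rewrite stA.
  (* With u = g x y in A, the map g_u sends f y x to x, so stability puts f y x in A. *)
  by split=> //; rewrite -(stA _ _ Ag) sol_ggf.
exists invA; split.
  move=> x; split; apply: injF_bij => y z /(congr1 val) /= E; apply: val_inj.
    exact: (sol_f_inj E).
  exact: (sol_g_inj E).
case: solS => _ _ [SK br]; split.
  move=> [x y]; rewrite /restrict_solution /=.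
  by congr pair; apply: val_inj; rewrite /= -surjective_pairing SK.
move=> [[x y] z]; have E := br (val x, val y, val z).
have ext3 (u v : {x | x \in A} * {x | x \in A} * {x | x \in A}) :
    val u.1.1 = val v.1.1 -> val u.1.2 = val v.1.2 -> val u.2 = val v.2 -> u = v.
  by case: u v => [[? ?] ?] [[? ?] ?] /= /val_inj-> /val_inj-> /val_inj->.
apply: ext3; rewrite /=.
- exact: (congr1 (fun p => p.1.1) E).
- exact: (congr1 (fun p => p.1.2) E).
- exact: (congr1 snd E).
Qed.

(** * Elements of constant weight on two blocks *)

Section Bipartition.
Variable Y : {set X}.
Hypothesis gY : forall x y, (g x y \in Y) = (y \in Y).

Definition blockwise : set G :=
  [set a | M a /\ forall z w, (z \in Y) = (w \in Y) -> weight a z = weight a w].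

Lemma sg_act_block a z : M a -> (sg_act a z \in Y) = (z \in Y).
Proof.
move=> Ma; move: a Ma z; apply: monoid_ind => [|x b _ IH] z.
  by rewrite sg_act1.
by rewrite sg_actM IH -{2}(sol_g_act x z) gY.
Qed.
Lemma blockwise1 : blockwise 1.
Proof. by split=> [|z w _]; rewrite ?weight1; first exact: monoid1. Qed.

Lemma blockwise_submonoid : is_submonoid blockwise.
Proof.
split=> [|a b [Ma ca] [Mb cb]]; first exact: blockwise1.
split=> [|z w E]; first exact: monoidM.
by rewrite !weightM (ca z w E); congr (_ + _); apply: cb; rewrite !sg_act_block.
Qed.

(** * Quotients and right divisibility of blockwise elements *)

Lemma blockwise_sol_r a b : blockwise a -> M b -> blockwise (a * b) -> blockwise b.
Proof.
move=> [Ma ca] Mb [_ cab]; split=> // z w.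
have [[u ->] [v ->]] := (sg_act_surj a z, sg_act_surj a w).
rewrite !sg_act_block // => E; move: (cab u v E).
by rewrite !weightM (ca u v E); lia.
Qed.

Lemma blockwise_sol_l a b : M a -> blockwise b -> blockwise (a * b) -> blockwise a.
Proof.
move=> Ma [Mb cb] [_ cab]; split=> // z w E; move: (cab z w E).
by rewrite !weightM (cb _ (sg_act a w)) ?sg_act_block //; lia.
Qed.

(** As M preserves both blocks, translation does not affect such a weight: the cocycle becomes
    additive, and right divisibility is pointwise as well. *)
Lemma blockwise_weight_act a b z : blockwise a -> M b ->
  weight a (sg_act b z) = weight a z.
Proof. by move=> [Ma ca] Mb; apply: ca; rewrite sg_act_block. Qed.

(** Here the multiple is blockwise; in [weight_rdivisor] it is the divisor. The two bound a gcd or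
    lcm not yet known to be blockwise. *)
Lemma weight_rdivides a b z : blockwise b -> M a -> rdivides M a b ->
  weight a z <= weight b z.
Proof.
move=> cb Ma [t Mt E]; have [w Ew] := sg_act_surj t z.
rewrite {2}Ew (blockwise_weight_act _ cb Mt) E weightM -Ew.
by have := weight_ge0 w Mt; lia.
Qed.

Lemma weight_rdivisor a b z : blockwise a -> M b -> rdivides M a b ->
  weight a z <= weight b z.
Proof.
move=> ca Mb [t Mt ->]; rewrite weightM (blockwise_weight_act _ ca Mt).
by have := weight_ge0 z Mt; lia.
Qed.

Lemma blockwise_rdivides a b : blockwise a -> M b ->
  (forall z, weight a z <= weight b z) -> rdivides M a b.
Proof.
move=> ca Mb le_ab; have [Ma _] := ca.
have [t Mt Et] := exists_weight (fun z => `|weight b z - weight a z|%N).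
exists t => //; apply: weight_inj => //; first exact: monoidM.
move=> z; rewrite weightM blockwise_weight_act // Et.
by have := le_ab z; lia.
Qed.

Lemma exists_blockwise (v : X -> nat) :
  (forall z w, (z \in Y) = (w \in Y) -> v z = v w) ->
  exists2 c, blockwise c & forall z, weight c z = v z.
Proof.
move=> cv; have [c Mc Ec] := exists_weight v.
by exists c => //; split=> // z w E; rewrite !Ec (cv z w E).
Qed.

(** The pointwise minimum is the weight of a blockwise common divisor c; c divides d, and d divides
    a and b, which pins the weight of d. *)
Lemma weight_right_gcd a b d z : blockwise a -> blockwise b ->
  is_right_gcd M a b d -> weight d z = Num.min (weight a z) (weight b z).
Proof.
move=> ca cb [Md da db max_d]; have [[Ma ca'] [Mb cb']] := (ca, cb).
have [|c cc Ec] := @exists_blockwise (fun z => minn `|weight a z|%N `|weight b z|%N).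
  by move=> u w E; rewrite (ca' u w E) (cb' u w E).
have {}Ec w : weight c w = Num.min (weight a w) (weight b w).
  by rewrite Ec; have := weight_ge0 w Ma; have := weight_ge0 w Mb; lia.
have /(weight_rdivisor z cc Md) : rdivides M c d.
  by apply: max_d; first (by case: cc); apply: blockwise_rdivides => // w; rewrite Ec; lia.
by have := weight_rdivides z ca Md da; have := weight_rdivides z cb Md db; rewrite Ec; lia.
Qed.

Lemma weight_left_lcm a b m z : blockwise a -> blockwise b ->
  is_left_lcm M a b m -> weight m z = Num.max (weight a z) (weight b z).
Proof.
move=> ca cb [Mm am bm min_m]; have [[Ma ca'] [Mb cb']] := (ca, cb).
have [|c cc Ec] := @exists_blockwise (fun z => maxn `|weight a z|%N `|weight b z|%N).
  by move=> u w E; rewrite (ca' u w E) (cb' u w E).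
have {}Ec w : weight c w = Num.max (weight a w) (weight b w).
  by rewrite Ec; have := weight_ge0 w Ma; have := weight_ge0 w Mb; lia.
have [Mc _] := cc.
have /(weight_rdivides z cc Mm) : rdivides M m c.
  by apply: min_m => //; apply: blockwise_rdivides => // w; rewrite Ec; lia.
by have := weight_rdivisor z ca Mm am; have := weight_rdivisor z cb Mm bm; rewrite Ec; lia.
Qed.

Lemma blockwise_lattice a b m : blockwise a -> blockwise b ->
  [/\ is_left_gcd M a b m -> blockwise m, is_right_lcm M a b m -> blockwise m,
      is_right_gcd M a b m -> blockwise m & is_left_lcm M a b m -> blockwise m].
Proof.
move=> ca cb; have [[Ma ca'] [Mb cb']] := (ca, cb).
split=> /[dup] -[Mm _ _ _] mP; split=> // z w E.
- by rewrite !(weight_left_gcd _ Ma Mb mP) (ca' z w E) (cb' z w E).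
- by rewrite !(weight_right_lcm _ Ma Mb mP) (ca' z w E) (cb' z w E).
- by rewrite !(weight_right_gcd _ ca cb mP) (ca' z w E) (cb' z w E).
- by rewrite !(weight_left_lcm _ ca cb mP) (ca' z w E) (cb' z w E).
Qed.

Lemma blockwise_deltaT : blockwise (delta [set: X]).
Proof. by split=> [|z w _]; [exact: monoid_delta | rewrite !weight_delta !inE]. Qed.

Lemma blockwise_delta : blockwise (delta Y).
Proof. by split=> [|z w E]; [exact: monoid_delta | rewrite !weight_delta E]. Qed.

Lemma blockwise_deltaC : blockwise (delta (~: Y)).
Proof. by split=> [|z w E]; [exact: monoid_delta | rewrite !weight_delta !inE E]. Qed.

Lemma delta_mul : delta Y * delta (~: Y) = delta [set: X].
Proof.
have [Md MdC] := (monoid_delta Y, monoid_delta (~: Y)).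
apply: weight_inj => [||z]; [exact: monoidM | exact: monoid_delta |].
by rewrite weightM blockwise_weight_act ?weight_delta ?inE //;
  [lia | exact: blockwise_deltaC].
Qed.

Lemma delta_mulC : delta (~: Y) * delta Y = delta [set: X].
Proof.
have [Md MdC] := (monoid_delta Y, monoid_delta (~: Y)).
apply: weight_inj => [||z]; [exact: monoidM | exact: monoid_delta |].
by rewrite weightM blockwise_weight_act ?weight_delta ?inE //;
  [lia | exact: blockwise_delta].
Qed.

(** * The Garside submonoid of blockwise elements and its atoms *)

Variables y0 z0 : X.
Hypotheses (Yy0 : y0 \in Y) (Yz0 : z0 \notin Y).

(** A nontrivial blockwise element is positive on some whole block B, so [delta B] splits off on the
    left and the quotient is blockwise. The values at the representatives [y0] and [z0] determine
    the weight, and their sum drops. *)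
Lemma blockwise_ind (P : set G) : P 1 ->
  (forall a b, a = delta Y \/ a = delta (~: Y) -> blockwise b -> P b -> P (a * b)) ->
  blockwise `<=` P.
Proof.
move=> P1 PM a.
move: {2}(absz (weight a y0 + weight a z0)%R)
  (leqnn (absz (weight a y0 + weight a z0)%R)) => n.
elim: n a => [|n IH] a le_n ca; have [Ma ca'] := ca.
  suff -> : a = 1 by [].
  apply: weight_eq0 => // z.
  have [Yz|Yz] := boolP (z \in Y); [rewrite (ca' z y0) ?Yz ?Yy0 //|
    rewrite (ca' z z0) ?(negbTE Yz) ?(negbTE Yz0) //];
    by have := weight_ge0 y0 Ma; have := weight_ge0 z0 Ma; lia.
have [->//|/(exists_weight_gt0 Ma)[z az]] := EM (a = 1).
pose B := if z \in Y then Y else ~: Y.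
have dB : delta B = delta Y \/ delta B = delta (~: Y).
  by rewrite /B; case: ifP; [left | right].
have cB : blockwise (delta B).
  by case: dB => ->; [exact: blockwise_delta | exact: blockwise_deltaC].
have BE w : (w \in B) = ((w \in Y) == (z \in Y)).
  by rewrite /B; case: ifP; rewrite ?inE; case: (w \in Y).
have [|t Mt E] := (ldividesP (monoid_delta B) Ma).2.
  move=> w; rewrite weight_delta BE; case: eqP => [Ew|_]; last exact: weight_ge0.
  by rewrite (ca' w z Ew).
have ct : blockwise t by apply: (blockwise_sol_r cB) => //; rewrite -E.
rewrite E; apply: PM => //; apply: IH => //.
have Wt w : weight a w = (w \in B)%:Z + weight t w.
  rewrite E weightM weight_delta blockwise_weight_act //; exact: monoid_delta.
move: le_n; rewrite !Wt !BE Yy0 (negbTE Yz0).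
have := weight_ge0 y0 Mt; have := weight_ge0 z0 Mt.
by case: (z \in Y) => /=; lia.
Qed.

Lemma delta_Div A : Div M (delta [set: X]) (delta A).
Proof.
apply/Div_DeltaP; split=> [|z]; first exact: monoid_delta.
by rewrite weight_delta; case: (z \in A).
Qed.

Lemma garside_blockwise : garside_submonoid M blockwise.
Proof.
have DrE : rdivisors M (delta [set: X]) = Div M (delta [set: X]).
  by apply: rdivisors_delta stableT.
have Dldiv := @Div_ldivides (delta [set: X]).
have Drdiv := Div_delta_rdivides stableT.
(* The weights here are the indicators of the empty set, of the two blocks and of X. *)
pose D := blockwise `&` Div M (delta [set: X]).
have Dlat x y m : D x -> D y ->
    [/\ is_left_gcd M x y m -> D m, is_right_lcm M x y m -> D m,
        is_right_gcd M x y m -> D m & is_left_lcm M x y m -> D m].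
  move=> [cx Dx] [cy Dy]; have [H1 H2 H3 H4] := blockwise_lattice m cx cy.
  have [[Mx dx] [My dy]] := (Dx, Dy).
  split=> /[dup] -[Mm mx my ext] mP; split; try by auto.
  - exact: Dldiv mx Dx.
  - by split=> //; apply: ext => //; apply: monoid_delta.
  - exact: Drdiv mx Dx.
  - rewrite -DrE; split=> //; move: Dx Dy; rewrite -DrE => -[_ Dx] [_ Dy].
    by apply: ext => //; apply: monoid_delta.
exists (delta [set: X]); split; first exact: the_garside_monoid.
exists D; split.
- split; last by move=> a [].
  by exists (delta [set: X]); split; [exact: blockwise_deltaT | exact: delta_Div].
- have [gen1 genM] := is_submonoid_gen D.
  apply/seteqP; split.
    by apply: gen_monoid_min blockwise_submonoid _ => a [].
  apply: blockwise_ind => // a b Ea _; apply: genM; apply: gen_monoid_incl.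
  by case: Ea => ->; (split; last exact: delta_Div);
    [exact: blockwise_delta | exact: blockwise_deltaC].
- exact: Dlat.
- move=> x y z Dx Dy; have [[cx [Mx _]] [cy [My _]]] := (Dx, Dy).
  split=> -[Mz zP].
    have [_ /(_ zP)[cxz Dxz] _ _] := Dlat x y (x * z) Dx Dy.
    split; first exact: (blockwise_sol_r cx).
    by apply: Drdiv Dxz => //; exists x.
  have [_ _ _ /(_ zP)[czx Dzx]] := Dlat x y (z * x) Dx Dy.
  split; first exact: (blockwise_sol_l _ cx).
  by apply: Dldiv Dzx => //; exists x.
- move=> x y d [cx _] [cy _].
  have cxy : blockwise (x * y) by have [_] := blockwise_submonoid; apply.
  have [H1 _ H3 _] := blockwise_lattice d cxy blockwise_deltaT.
  split=> /[dup] -[Md _ dD _] dP; split; try by auto.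
  by rewrite -DrE; split.
Qed.

Lemma delta_neq1 (A : {set X}) z : z \in A -> delta A <> 1.
Proof.
move=> Az /(congr1 (fun a => weight a z)).
by rewrite weight_delta weight1 Az.
Qed.

Lemma atoms_blockwise : atoms blockwise = [set delta Y; delta (~: Y)].
Proof.
have Cz0 : z0 \in ~: Y by rewrite inE.
apply/seteqP; split=> a.
  move=> [ca a1 fa]; move: a ca a1 fa.
  apply: (@blockwise_ind (fun a => a <> 1 -> _ -> _)) => // a b Ea cb _ _ fa.
  have ca : blockwise a.
    by case: Ea => ->; [exact: blockwise_delta | exact: blockwise_deltaC].
  have [a1|->] := fa a b ca cb erefl; last by rewrite mulg1.
  by case: Ea a1 => -> /(@delta_neq1 _ _ _)H; [case: (H y0) | case: (H z0)].
(* A lies in one block, so blockwise factors b and c are constant on A; their weights add up to 1_A,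
   hence one of them vanishes. *)
have key (A : {set X}) : (forall z w, z \in A -> w \in A -> (z \in Y) = (w \in Y)) ->
    blockwise (delta A) -> A != finset.set0 -> atoms blockwise (delta A).
  move=> YA cA /set0Pn[u Au]; split=> //; first exact: delta_neq1 Au.
  move=> b c [Mb cb] [Mc cc] E.
  have W z : (z \in A)%:Z = weight b z + weight c z.
    by rewrite -weight_delta E weightM blockwise_weight_act.
  have [b0|b0] := eqVneq (weight b u) 0; [left | right];
    apply: weight_eq0 => // z;
    have := W z; have := weight_ge0 z Mb; have := weight_ge0 z Mc;
    have [Az|_] := boolP (z \in A); try lia.
    by rewrite (cb z u) ?b0 ?(YA z u).
  have := W u; have := weight_ge0 u Mb; have := weight_ge0 u Mc.
  by rewrite (cb z u) ?(cc z u) ?(YA z u) ?Au //; lia.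
case=> ->; apply: key.
- by move=> z w -> ->.
- exact: blockwise_delta.
- by apply/set0Pn; exists y0.
- by move=> z w; rewrite !inE => /negbTE-> /negbTE->.
- exact: blockwise_deltaC.
- by apply/set0Pn; exists z0.
Qed.

(** Both lcms of the two elements have weight 1 everywhere, so they equal [delta [set: X]], the
    product in either order; cancellation shows that each complement is the other element. *)
Lemma deltas_complement_closed : complement_closed [set delta Y; delta (~: Y)].
Proof.
have key a b z : M a -> M b -> blockwise a -> blockwise b ->
  (forall u, Num.max (weight a u) (weight b u) = 1%:Z) ->
  a * b = delta [set: X] -> b * a = delta [set: X] ->
  is_right_complement M a b z \/ is_left_complement M a b z -> z = b.
  move=> Ma Mb ca cb W Eab Eba [] [Mz zP].
    apply: (mulgI a); rewrite Eab; apply: weight_inj => [||u].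
    - exact: monoidM.
    - exact: monoid_delta.
    - by rewrite (weight_right_lcm _ Ma Mb zP) weight_delta W inE.
  apply: (mulIg a); rewrite Eba; apply: weight_inj => [||u].
  - exact: monoidM.
  - exact: monoid_delta.
  - by rewrite (weight_left_lcm _ ca cb zP) weight_delta W inE.
have [Md MdC] := (monoid_delta Y, monoid_delta (~: Y)).
have [cd cdC] := (blockwise_delta, blockwise_deltaC).
have [E1 E2] := (delta_mul, delta_mulC).
move=> a b z [] -> [] -> // _; split=> zP.
- by right; apply: (key (delta Y)); auto => u; rewrite !weight_delta inE; lia.
- by right; apply: (key (delta Y)); auto => u; rewrite !weight_delta inE; lia.
- by left; apply: (key (delta (~: Y))); auto => u; rewrite !weight_delta inE; lia.
- by left; apply: (key (delta (~: Y))); auto => u; rewrite !weight_delta inE; lia.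
Qed.

(** * The strong folding given by a decomposition *)

Lemma stable_block : stable Y.
Proof. by move=> x y _. Qed.

Lemma stable_blockC : stable (~: Y).
Proof. by move=> x y _; rewrite !inE gY. Qed.

Lemma deltas_strong_folding : (2 < #|X|)%N ->
  @strong_folding X S [set delta Y; delta (~: Y)] (fun p => (p.2, p.1)).
Proof.
move=> X2.
have neYC : Y != (~: Y)%SET.
  by apply/eqP => /setP/(_ y0); rewrite inE Yy0.
exists [set Y; ~: Y]%SET; last first.
  move=> A; rewrite !inE => /orP[] /eqP ->;
    apply: generates_standard_parabolic_stable.
    exact: stable_block.
  exact: stable_blockC.
split.
  split; last by rewrite cards2 neYC.
  apply/and3P; split.
  - by rewrite /finset.cover finset.bigcup_setU !big_set1 finset.setUCr.
  - apply/finset.trivIsetP => A B; rewrite !inE => /orP[] /eqP -> /orP[] /eqP -> //;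
      rewrite ?eqxx // => _; rewrite -setI_eq0 ?finset.setICr //.
    by rewrite finset.setIC finset.setICr.
  - rewrite !inE negb_or; apply/andP; split; rewrite eq_sym; apply/set0Pn.
      by exists y0.
    by exists z0; rewrite inE.
exists delta; split.
- move=> A; rewrite !inE => /orP[] /eqP ->; apply: generates_atomic_garside_delta.
    exact: stable_block.
  exact: stable_blockC.
- apply/seteqP; split=> a.
    by case=> ->; [exists Y | exists (~: Y)]; rewrite //= !inE eqxx ?orbT.
  by case=> A /=; rewrite !inE => /orP[] /eqP -> <-; [left | right].
- exact: deltas_complement_closed.
- by exists blockwise; [exact: garside_blockwise | exact: atoms_blockwise].
- split.
    split; first by exists (fun p => (p.2, p.1)) => -[].
      by move=> x; split; exists id.
    by split=> [[]|[[]]].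
  have mulP p q : [set delta Y; delta (~: Y)] p ->
      [set delta Y; delta (~: Y)] q -> p <> q ->
      [/\ M p, M q, p * q = delta [set: X]
        & forall z, Num.max (weight p z) (weight q z) = 1%:Z].
    move=> [] -> [] -> // _; split; try exact: monoid_delta;
      try exact: delta_mul; try exact: delta_mulC;
      by move=> z; rewrite !weight_delta inE; lia.
  (* The lcm of a and c is a c = c a, so a b = a c and c d = c a; cancelling, b = c and d = a, which
     is the flip. *)
  move=> a b c d ac E lcm_ac.
  have vac : val a <> val c by move=> /val_inj.
  have [Ma Mc Eac W] := mulP _ _ (set_mem (valP a)) (set_mem (valP c)) vac.
  have [_ _ Eca _] := mulP _ _ (set_mem (valP c)) (set_mem (valP a)) (nesym vac).
  have Eab : val a * val b = delta [set: X].
    have [Mab _ _ _] := lcm_ac.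
    apply: weight_inj => // [|z]; first exact: monoid_delta.
    by rewrite (weight_right_lcm _ Ma Mc lcm_ac) W weight_delta inE.
  congr pair; apply: val_inj => /=.
    by apply: (mulgI (val a)); rewrite Eab Eac.
  by apply: (mulgI (val c)); rewrite -E Eca Eab.
Qed.

End Bipartition.

Lemma decomposable_strong_folding : #|X| <> 2 -> decomposable S ->
  exists (X' : set G) (S' : X' * X' -> X' * X'),
    [/\ strong_folding S', trivial_solution S' & (X' #= `I_2)%card].
Proof.
move=> X2 [Y [Z [Y0 Z0 YZ0 YZT [[invY _] [invZ _]]]]].
have [/eqP/set0Pn[y0 Yy0] /eqP/set0Pn[z0 Zz0]] := (Y0, Z0).
have ZE z : (z \in Z) = (z \notin Y).
  move: YZ0 YZT => /finset.setP/(_ z) + /finset.setP/(_ z); rewrite !inE.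
  by case: (z \in Y) (z \in Z) => [] [].
(* For x in Z the map g_x preserves Z, hence also its complement Y. *)
have gY x y : (g x y \in Y) = (y \in Y).
  have [Yx|Yx] := boolP (x \in Y); first exact: (invariant_stable invY).
  apply: negb_inj; rewrite -!ZE; apply: (invariant_stable invZ).
  by rewrite ZE.
have Yz0 : z0 \notin Y by rewrite -ZE.
have X3 : (2 < #|X|)%N.
  suff : (1 < #|X|)%N by move: X2; lia.
  rewrite -cardsT (cardsD1 y0) (cardsD1 z0) !inE /= .
  by case: eqVneq Yz0 => [->|_ _ //]; rewrite Yy0.
exists [set delta Y; delta (~: Y)], (fun p => (p.2, p.1)); split.
- exact: (deltas_strong_folding gY Yy0 Yz0).
- by move=> x; split.
- apply/card_eq2P; exists (delta Y), (delta (~: Y)); split=> //.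
  by move=> /delta_inj/setP/(_ y0); rewrite inE Yy0.
Qed.

(** * Blocks of a strong folding *)

Lemma parabolic_supported N : standard_parabolic_submonoid M N ->
  exists A, stable A /\ N = supported A.
Proof.
case=> Delta [d [/the_garside_monoid_unique -> [Md _] /Div_DeltaP[_ le_d] <- ND]].
(* A divisor of the Garside element has weights 0 and 1 only, so it is [delta] of its support. *)
pose A : {set X} := [set z | weight d z == 1%:Z]%SET.
have AE z : weight d z = (z \in A)%:Z.
  by rewrite inE; have := le_d z; have := weight_ge0 z Md; lia.
have dE : d = delta A.
  by apply: weight_inj => // [|z]; rewrite ?weight_delta //; apply: monoid_delta.
have stA : stable A.
  apply: closed_stable => x y Ax Ay; have [->//|ne] := eqVneq (g x y) x.
  (* As g x y differs from x, the product x y has weights at most 1, so it divides the Garside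
     element; lying in N, it divides d, which therefore has weight 1 at g x y. *)
  have W z : weight (gen x * gen y) z = (z == x)%:Z + (z == g x y)%:Z.
    rewrite weightM !weight_gen -(inj_eq (@sg_act_inj (gen x)) z (g x y)).
    by rewrite sg_act_gen.
  have [gen1 genM] := is_submonoid_gen (Div M d).
  have DA z : z \in A -> gen_monoid (Div M d) (gen z).
    by move=> Az; apply: gen_monoid_incl; rewrite dE; apply: Div_delta_gen.
  have : (gen_monoid (Div M d) `&` Div M (delta [set: X])) (gen x * gen y).
    split; first by apply: genM; apply: DA.
    apply/Div_DeltaP; split=> [|z].
      by apply: monoidM; apply: monoid_gen.
    by rewrite W; have [->|_] := eqVneq z x; rewrite 1?eq_sym ?(negbTE ne) //;
      case: (_ == _).
  rewrite ND DivE // => -[_ /(_ (g x y))].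
  by rewrite W eqxx (negbTE ne) AE; case: (_ \in A).
by exists A; split=> //; rewrite dE gen_Div_delta.
Qed.

(** * Recovering a Garside submonoid from its group *)

Lemma garside_submonoid_sub N : garside_submonoid M N -> N `<=` M.
Proof.
case=> Delta [_ [D [[_ DM] <- _ _ _]]].
by apply: gen_monoid_min => [|a /DM[] //]; apply: is_submonoid_gen.
Qed.

(* Two factorizations x z = y v of the same element both factor through the
   right lcm of x and y, whose complements stay in D. *)
Lemma garside_submonoid_sol N a z : garside_submonoid M N ->
  N a -> M z -> N (a * z) -> N z.
Proof.
move=> gN Na Mz; have NM := garside_submonoid_sub gN.
case: gN => Delta [_ [D [[_ _] genD _ DC _]]]; rewrite -{}genD in Na NM *.
have [gen1 genM] := is_submonoid_gen D.
have DM x : D x -> M x by move=> Dx; apply: NM; apply: gen_monoid_incl.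
pose P v := forall x z, D x -> M z -> v = x * z -> gen_monoid D z.
have DP : gen_monoid D `<=` P.
  apply: gen_monoid_ind => [x w Dx Mw E|y v Dy gv IH x w Dx Mw E].
    suff -> : w = 1 by [].
    apply: weight_eq0 => // u; have [t ->] := sg_act_surj x u.
    have := weight1 t; rewrite E weightM.
    have := weight_ge0 t (DM x Dx).
    by have := weight_ge0 (sg_act x t) Mw; lia.
  have [Mx My] := (DM x Dx, DM y Dy).
  have [p [q [Mp Mq Epq lcm_p]]] := exists_right_lcm Mx My.
  have Dp : D p by apply: (DC x y p Dx Dy).1.
  have Dq : D q.
    apply: (DC y x q Dy Dx).1; split=> //; rewrite -Epq.
    by case: lcm_p => ? ? ? min; split=> // m *; apply: min.
  have [_ _ _ /(_ (x * w))[|||r Mr Er]] := lcm_p.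
  - exact: monoidM.
  - by exists w.
  - by exists v; first exact: NM.
  have -> : w = p * r by apply: (mulgI x); rewrite Er mulgA.
  apply: genM; first exact: gen_monoid_incl.
  by apply: (IH q r) => //; apply: (mulgI y); rewrite E Er Epq mulgA.
move: a Na z Mz; apply: gen_monoid_ind => [z _|x b Dx gb IH z Mz].
  by rewrite mul1g.
rewrite -mulgA => /DP/(_ x (b * z)) H; apply: IH => //; apply: H => //.
by apply: monoidM => //; apply: NM.
Qed.

(** For a in N some [delta A]^k a is supported in A, hence so is its factor a. For a letter x of A
    some d^k x lies in N, and left quotients stay in N. *)
Lemma garside_submonoid_supported N d A : stable A ->
  garside_submonoid M N -> garside_element N d ->
  gen_subgroup N = gen_subgroup (supported A) -> N = supported A.
Proof.
move=> stA gN gd E; have NM := garside_submonoid_sub gN.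
apply/seteqP; split=> [a Na|].
  have : gen_subgroup (supported A) a by rewrite -E; apply: gen_subgroup_incl.
  have [gA _] := the_garside_supported stA.
  move=> /(gen_subgroup_fraction gA)[k sk].
  have [Mk _] := garside_element_exp gA k.
  by have [] := supported_factor stA Mk (NM a Na) sk.
rewrite supportedE //; apply: gen_monoid_min.
  exact: garside_element_submonoid gd.
move=> _ [x Ax <-].
have : gen_subgroup N (gen x).
  by rewrite E; apply: gen_subgroup_incl; apply: supported_gen.
move=> /(gen_subgroup_fraction gd)[k Nk].
apply: garside_submonoid_sol Nk => //; first exact: garside_element_exp.
exact: monoid_gen.
Qed.

(* B may be a proper subset of A: distinct blocks can generate the same
   parabolic subgroup. *)
Lemma strong_block (B : {set X}) d : @generates_atomic_garside X S B d ->
  @generates_standard_parabolic X S B ->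
  exists A, [/\ stable A, B \subset A & d = delta A].
Proof.
move=> [N [gN _ EN gd]] [N' /parabolic_supported[A [stA ->]] EA].
exists A; split=> //.
  apply/fintype.subsetP => y By.
  have : gen_subgroup (supported A) (gen y).
    by rewrite EA; apply: gen_subgroup_incl; exists y.
  have [gA _] := the_garside_supported stA.
  move=> /(gen_subgroup_fraction gA)[k sk].
  have [Mk _] := garside_element_exp gA k.
  have [_ [_ sy]] := supported_factor stA Mk (monoid_gen y) sk.
  by apply: contraT => /sy; rewrite weight_gen eqxx.
apply: the_garside_supported_unique => //.
rewrite -(garside_submonoid_supported stA gN gd.1) //.
by rewrite EN EA.
Qed.

(** As A and B cover X, the lcm has weight 1 everywhere; since [delta A] permutes A, the complement
    p has weight 1 off A and 0 on A. Closure leaves p = [delta A], impossible for nonempty A, or p =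
    [delta B], which makes B miss A. *)
Lemma delta_complement_disjoint (A B : {set X}) : stable A -> A != finset.set0 ->
  (forall z, (z \in A) || (z \in B)) ->
  complement_closed [set delta A; delta B] -> A <> B ->
  (A :&: B)%SET = finset.set0.
Proof.
move=> stA /set0Pn[u Au] AB cc neAB.
have [MA MB] := (monoid_delta A, monoid_delta B).
have [p [q [Mp Mq _ lcm_p]]] := exists_right_lcm MA MB.
have W z : (z \in A)%:Z + weight p (sg_act (delta A) z) = 1%:Z.
  rewrite -weight_delta -weightM (weight_right_lcm _ MA MB lcm_p) !weight_delta.
  by have := AB z; lia.
have Xp : [set delta A; delta B] p.
  apply: (cc (delta A) (delta B) p _ _ _).1; [by left | by right | | by []].
  by move=> /delta_inj.
case: Xp => Ep.
  have := W u; rewrite Ep weight_delta supported_act ?Au //.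
  exact: supported_delta.
apply/finset.setP => v; rewrite !inE; apply/andP => -[Av Bv].
have [w Ew] := sg_act_surj (delta A) v.
have := W w; rewrite Ep weight_delta -Ew Bv.
by rewrite -(supported_act stA w (supported_delta A)) -Ew Av.
Qed.

Lemma strong_folding_decomposable (X' : set G) (S' : X' * X' -> X' * X') :
  strong_folding S' -> (X' #= `I_2)%card -> decomposable S.
Proof.
move=> [P [[partP _] [Delta [gP EX' cc _ _]]] spP] /card_eq2P[a [b [ab Eab]]].
have blockP B : B \in P -> exists A, [/\ stable A, B \subset A & Delta B = delta A].
  by move=> PB; apply: strong_block; [apply: gP | apply: spP].
have X'P c : X' c -> exists A, [/\ stable A, A != finset.set0 & c = delta A].
  rewrite EX' => -[B PB <-]; have [A [stA BA EB]] := blockP B PB.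
  exists A; split=> //; apply: contraTneq PB => A0.
  move: BA; rewrite A0 finset.subset0 => /eqP ->.
  by case/and3P: partP.
have [Xa Xb] : X' a /\ X' b by rewrite Eab; split; [left | right].
have [[A [stA A0 EA]] [B [stB B0 EB]]] := (X'P a Xa, X'P b Xb).
(* The block C of z lies in a stable A' with [Delta C] = [delta A']; this element is a or b, so A'
   is A or B by [delta_inj]. *)
have AB z : (z \in A) || (z \in B).
  case/and3P: partP => /eqP covP _ _.
  have : z \in finset.cover P by rewrite covP inE.
  case/bigcupP => C PC Cz; have [A' [_ /fintype.subsetP CA' EC]] := blockP C PC.
  have : X' (Delta C) by rewrite EX'; exists C.
  by rewrite Eab EC EA EB => -[] /delta_inj <-; rewrite CA' ?orbT.
exists A, B; split; try exact/eqP.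
- apply: delta_complement_disjoint => //; first by rewrite -EA -EB -Eab.
  by move=> E; apply: ab; rewrite EA EB E.
- by apply/finset.setP => z; rewrite !inE AB.
- by split; apply: stable_nondeg_invariant.
Qed.

End Weight.

(** A two-point set has no proper partition, hence no folding, although the trivial solution on it
    is decomposable; [#|X| <> 2] excludes this case. *)
Theorem theorem2 (X : finType) (S : X * X -> X * X) :
  nondeg_symmetric_solution S ->
  #|X| <> 2 ->
  decomposable S <->
  exists (X' : set (structure_group S)) (S' : X' * X' -> X' * X'),
    [/\ strong_folding S', trivial_solution S' & (X' #= `I_2)%card].
Proof.
move=> solS X2; split; first exact: decomposable_strong_folding.
by move=> [X' [S' [fold _ /(strong_folding_decomposable solS fold)]]].
Qed.
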